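(* Let $X$ be a compact metric space with the limited anti-Specker property $\mathbf{AS}_L^X$, and let $f$ be a Z-stable, uniformly continuous mapping of $X$ into a normed space $Y$ such that $Z_f=\{x\in X:f(x)=0\}$ is separable. Then $f$ is uniformly Z-stable on $X$.
   Context: The setting is Bishop-style constructive mathematics (BISH): intuitionistic logic together with dependent choice; neither the law of excluded middle, nor LPO, nor Markov's principle may be used. A metric space is compact if it is complete and totally bounded. A set $S$ in a metric space is separable if there is a sequence of points of $S$ that is dense in $S$. $\rho$ denotes the metric. For $S\subset X$ and $\varepsilon>0$, the expression $\rho(x,S)<\varepsilon$ means that there exists $y\in S$ with $\rho(x,y)<\varepsilon$; and $\rho(x,S)>0$ means that there exists $\delta>0$ such that $\rho(x,y)\geqslant\delta$ for all $y\in S$. For $f:X\to Y$ with zero set $Z_f=\{x\in X:f(x)=0\}$: - $f$ is Z-stable at the point $x\in X$ if for each $\varepsilon>0$ there exists $\delta>0$ such that if $\|f(x)\|<\delta$, then $\rho(x,Z_f)<\varepsilon$; - $f$ is Z-stable (on $X$) if it is Z-stable at each point of $X$; - $f$ is uniformly Z-stable on $X$ if for each $\varepsilon>0$ there exists $\delta>0$ such that for each $x\in X$, if $\|f(x)\|<\delta$, then $\rho(x,Z_f)<\varepsilon$. If $X$ is a subspace of a metric space $(E,\rho)$ and $\omega\in E$ satisfies $\rho(\omega,X)>0$, then the metric space $X\cup\{\omega\}$ is called a one-point extension of $X$. A sequence $(x_n)_{n\geqslant1}$ in $E$ is eventually bounded away from the point $x\in E$ if there exist $N$ and $\delta>0$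 such that $\rho(x,x_n)\geqslant\delta$ for all $n\geqslant N$. The limited anti-Specker property $\mathbf{AS}_L^X$: if $X\cup\{\omega\}$ is a one-point extension of $X$, and $(x_n)_{n\geqslant1}$ is a sequence in $X\cup\{\omega\}$ that is eventually bounded away from each point of $X$, then there exists $n$ such that $x_n=\omega$. (This property does not depend on the choice of one-point extension of $X$.) *)

(* Defs.v *)
From Stdlib Require Export QArith.
From Stdlib Require Export ConstructiveReals ConstructiveAbs.
From Stdlib Require Export RelationClasses.
From Stdlib Require Fin.

(* Bishop-style mathematics under the propositions-as-types reading.  Asserted
   existence and disjunction are rendered by [sigT]/[sig], [prod] and [sum]
   rather than by [exists] and [\/] in [Prop], so that dependent choice holds by
   projection and needs no axiom.  The order [<] of [ConstructiveReals] is
   likewise [Set]-valued; [<=] and [==] are negative, hence in [Prop]. *)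

Local Open Scope ConstructiveReals.

(* The equality [meq] of a metric space is automatically an equivalence
   relation for which [dist] is extensional, by the metric axioms. *)
Record MetricSpace (R : ConstructiveReals) : Type := {
  mcarrier :> Type;
  meq : mcarrier -> mcarrier -> Prop;
  dist : mcarrier -> mcarrier -> CRcarrier R;
  dist_nonneg : forall x y, 0 <= dist x y;
  dist_zero : forall x y, dist x y == 0 <-> meq x y;
  dist_sym : forall x y, dist x y == dist y x;
  dist_triangle : forall x y z, dist x z <= dist x y + dist y z
}.

Arguments meq {R m} x y.
Arguments dist {R m} x y.

Record NormedSpace (R : ConstructiveReals) : Type := {
  vcarrier :> Type;
  veq : vcarrier -> vcarrier -> Prop;
  vzero : vcarrier;
  vadd : vcarrier -> vcarrier -> vcarrier;
  vopp : vcarrier -> vcarrier;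
  vscal : CRcarrier R -> vcarrier -> vcarrier;
  norm : vcarrier -> CRcarrier R;

  veq_equiv : Equivalence veq;
  vadd_ext : forall u u' v v',
    veq u u' -> veq v v' -> veq (vadd u v) (vadd u' v');
  vopp_ext : forall u u', veq u u' -> veq (vopp u) (vopp u');
  vscal_ext : forall a a' u u',
    a == a' -> veq u u' -> veq (vscal a u) (vscal a' u');
  norm_ext : forall u u', veq u u' -> norm u == norm u';

  vadd_assoc : forall u v w, veq (vadd u (vadd v w)) (vadd (vadd u v) w);
  vadd_comm : forall u v, veq (vadd u v) (vadd v u);
  vadd_zero : forall u, veq (vadd u vzero) u;
  vadd_opp : forall u, veq (vadd u (vopp u)) vzero;
  vscal_one : forall u, veq (vscal 1 u) u;
  vscal_mult : forall a b u, veq (vscal (a * b) u) (vscal a (vscal b u));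
  vscal_add_r : forall a u v,
    veq (vscal a (vadd u v)) (vadd (vscal a u) (vscal a v));
  vscal_add_l : forall a b u,
    veq (vscal (a + b) u) (vadd (vscal a u) (vscal b u));

  norm_nonneg : forall u, 0 <= norm u;
  norm_zero : forall u, norm u == 0 <-> veq u vzero;
  norm_scal : forall a u, norm (vscal a u) == CRabs R a * norm u;
  norm_triangle : forall u v, norm (vadd u v) <= norm u + norm v
}.

Arguments veq {R n} u v : rename.
Arguments vzero {R n}.
Arguments vadd {R n} u v : rename.
Arguments vopp {R n} u : rename.
Arguments vscal {R n} a u : rename.
Arguments norm {R n} u : rename.

Section Metric.

Context {R : ConstructiveReals} {X : MetricSpace R}.

Definition dist_to_lt (x : X) (S : X -> Type) (eps : CRcarrier R) : Type :=
  { y : X & (S y * (dist x y < eps))%type }.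

Definition dist_to_pos (x : X) (S : X -> Type) : Type :=
  { delta : CRcarrier R &
    ((0 < delta) * (forall y : X, S y -> delta <= dist x y))%type }.

Definition separable (S : X -> Type) : Type :=
  { s : nat -> X &
    ((forall n, S (s n)) *
     (forall x, S x -> forall eps, 0 < eps ->
        { n : nat & dist x (s n) < eps }))%type }.

Definition cauchy (s : nat -> X) : Type :=
  forall eps : CRcarrier R, 0 < eps ->
    { N : nat | forall m n, (N <= m)%nat -> (N <= n)%nat ->
                  dist (s m) (s n) <= eps }.

Definition converges_to (s : nat -> X) (l : X) : Type :=
  forall eps : CRcarrier R, 0 < eps ->
    { N : nat | forall n, (N <= n)%nat -> dist (s n) l <= eps }.

Definition eventually_bounded_away (s : nat -> X) (x : X) : Type :=
  { N : nat & { delta : CRcarrier R &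
    ((0 < delta) *
     (forall n, (N <= n)%nat -> delta <= dist x (s n)))%type } }.

End Metric.

Definition complete {R : ConstructiveReals} (X : MetricSpace R) : Type :=
  forall s : nat -> X, cauchy s -> { l : X & converges_to s l }.

Definition totally_bounded {R : ConstructiveReals} (X : MetricSpace R) : Type :=
  forall eps : CRcarrier R, 0 < eps ->
    { n : nat & { a : Fin.t n -> X &
      forall x : X, { i : Fin.t n & dist x (a i) < eps } } }.

Definition compact {R : ConstructiveReals} (X : MetricSpace R) : Type :=
  (complete X * totally_bounded X)%type.

Section LimitedAntiSpecker.

Context {R : ConstructiveReals}.

(* "X is a subspace of E" is given by an isometric embedding [i : X -> E]. *)
Definition isometric {X E : MetricSpace R} (i : X -> E) : Prop :=
  forall x y : X, dist (i x) (i y) == dist x y.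

Definition image {X E : MetricSpace R} (i : X -> E) (e : E) : Type :=
  { x : X | meq e (i x) }.

Definition adjoin {X E : MetricSpace R} (i : X -> E) (omega : E) (e : E) : Type :=
  (image i e + meq e omega)%type.

Definition one_point_extension {X E : MetricSpace R} (i : X -> E) (omega : E)
  : Type :=
  (isometric i * dist_to_pos omega (image i))%type.

Definition limited_anti_Specker (X : MetricSpace R) : Type :=
  forall (E : MetricSpace R) (i : X -> E) (omega : E),
    one_point_extension i omega ->
    forall s : nat -> E,
      (forall n, adjoin i omega (s n)) ->
      (forall x : X, eventually_bounded_away s (i x)) ->
      { n : nat | meq (s n) omega }.

End LimitedAntiSpecker.

Section ZStability.

Context {R : ConstructiveReals} {X : MetricSpace R} {Y : NormedSpace R}.

Definition zero_set (f : X -> Y) (x : X) : Prop := veq (f x) vzero.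

(* Implies that [f] is extensional for [meq] and [veq]. *)
Definition uniformly_continuous (f : X -> Y) : Type :=
  forall eps : CRcarrier R, 0 < eps ->
    { delta : CRcarrier R &
      ((0 < delta) *
       (forall x y : X, dist x y < delta ->
          norm (vadd (f x) (vopp (f y))) < eps))%type }.

Definition Z_stable_at (f : X -> Y) (x : X) : Type :=
  forall eps : CRcarrier R, 0 < eps ->
    { delta : CRcarrier R &
      ((0 < delta) *
       (norm (f x) < delta -> dist_to_lt x (zero_set f) eps))%type }.

Definition Z_stable (f : X -> Y) : Type :=
  forall x : X, Z_stable_at f x.

Definition uniformly_Z_stable (f : X -> Y) : Type :=
  forall eps : CRcarrier R, 0 < eps ->
    { delta : CRcarrier R &
      ((0 < delta) *
       (forall x : X, norm (f x) < delta ->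
          dist_to_lt x (zero_set f) eps))%type }.

End ZStability.

(* Main.v *)
Require Import Defs.
From Stdlib Require Import ConstructiveMinMax Lia.

(** Fix [eps > 0] and [0 < q < eps / 2], and let [z] be dense in the zero set.  At
    stage [n], search a sufficiently fine finite net for a point [y] with
    [norm (f y) < 1 / (n + 1)] that is farther than [q] from [z 0, ..., z n].
    A fruitless search yields a [delta] witnessing uniform Z-stability for
    [eps], so let [x_n] be the point found, and the extra point of a one-point
    extension if there is none.  Near a point [x] with [norm (f x) > 0],
    continuity forbids late [x_n]; if [norm (f x)] is small, Z-stability at [x]
    puts some [z k] close to [x], which also forbids late [x_n].  The limited
    anti-Specker property now says that some search is fruitless. *)

Local Open Scope ConstructiveReals.

(** * Inequalities between constructive reals *)

Lemma CRlt_cotrans {R : ConstructiveReals} (x y z : CRcarrier R) :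
  x < z -> (x < y) + (y < z).
Proof. destruct (CRltLinear R) as [_ cotrans]; apply cotrans. Qed.

Lemma CRplus_lt_compat {R : ConstructiveReals} (a b c d : CRcarrier R) :
  a < b -> c < d -> a + c < b + d.
Proof.
  intros ab cd; apply CRplus_lt_le_compat; [exact ab | now apply CRlt_asym].
Qed.

Lemma CRpositive_half {R : ConstructiveReals} (eps : CRcarrier R) :
  0 < eps ->
  { h : CRcarrier R & ((0 < h) * ((h + h)%ConstructiveReals <= eps))%type }.
Proof.
  intros eps_pos; destruct (CR_Q_dense R _ _ eps_pos) as [q [q_pos q_lt]].
  exists (CR_of_Q R (q * (1 # 2))); split.
  - apply CR_of_Q_lt; apply lt_CR_of_Q in q_pos.
    rewrite <- (Qmult_0_l (1 # 2)); now apply Qmult_lt_compat_r.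
  - rewrite <- CR_of_Q_plus, (CR_of_Q_morph R _ q) by ring.
    now apply CRlt_asym.
Qed.

Definition CRinv_succ (R : ConstructiveReals) (n : nat) : CRcarrier R :=
  CR_of_Q R (1 # Pos.of_succ_nat n).

Lemma CRinv_succ_pos (R : ConstructiveReals) (n : nat) : 0 < CRinv_succ R n.
Proof. now apply CR_of_Q_lt. Qed.

Lemma CRinv_succ_small {R : ConstructiveReals} (eps : CRcarrier R) :
  0 < eps ->
  { N : nat | forall n, (N <= n)%nat -> CRinv_succ R n <= eps }.
Proof.
  intros eps_pos; destruct (CR_Q_dense R _ _ eps_pos) as [[a b] [q_pos q_lt]].
  (* Positivity forces [a >= 1], so [n >= b] gives [1/(n+1) <= 1/b <= a/b]. *)
  exists (Pos.to_nat b); intros n n_ge.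
  apply (CRle_trans _ (CR_of_Q R (a # b))); [|now apply CRlt_asym].
  apply lt_CR_of_Q in q_pos; apply CR_of_Q_le.
  unfold Qlt, Qle in *; simpl in *; nia.
Qed.

(** * Finite searches *)

(** [P] and [Q] may overlap, so the approximate comparisons supplied by cotransitivity can replace
    decidable tests. *)
Lemma Fin_search (n : nat) (P Q : Fin.t n -> Type) :
  (forall i, P i + Q i) -> { i : Fin.t n & P i } + (forall i, Q i).
Proof.
  induction n as [|n IHn]; intros dec.
  - right; intros i; now apply Fin.case0.
  - destruct (IHn (fun i => P (Fin.FS i)) (fun i => Q (Fin.FS i))
                (fun i => dec (Fin.FS i)))
      as [[i Pi]|all_Q]; [left; now exists (Fin.FS i) |].
    destruct (dec Fin.F1) as [P1|Q1]; [left; now exists Fin.F1 |].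
    right; intros i; now apply (Fin.caseS' i).
Qed.

Lemma bounded_search (P Q : nat -> Type) (n : nat) :
  (forall k, P k + Q k) ->
  { k : nat & P k } + (forall k, (k <= n)%nat -> Q k).
Proof.
  intros dec; induction n as [|n [found|IHn]].
  - destruct (dec 0%nat) as [P0|Q0]; [left; now exists 0%nat | right].
    intros k k_le; now replace k with 0%nat by lia.
  - now left.
  - destruct (dec (S n)) as [Pn|Qn]; [left; now exists (S n) | right].
    intros k k_le; destruct (Compare_dec.le_lt_dec k n) as [k_le'|k_gt].
    + now apply IHn.
    + now replace k with (S n) by lia.
Qed.

(** * Adjoining a point to a metric space *)

Section Metric.

Context {R : ConstructiveReals} {X : MetricSpace R}.

Lemma dist_triangle_lt (x y z : X) (a b c : CRcarrier R) :
  dist x y < a -> dist y z < b -> a + b <= c -> dist x z < c.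
Proof.
  intros xy yz abc; apply (CRlt_le_trans _ (a + b)); [|exact abc].
  eapply CRle_lt_trans; [apply (dist_triangle _ _ x y z)|].
  now apply CRplus_lt_compat.
Qed.

Lemma dist_sym_lt (x y : X) (a : CRcarrier R) : dist x y < a -> dist y x < a.
Proof. intros xy; eapply CRle_lt_trans; [apply dist_sym | exact xy]. Qed.

(* [MetricSpace] does not force [dist x x == 0]: a one-point carrier with
   constant distance [1] and empty [meq] satisfies its axioms.  Total
   boundedness does, by the triangle [x], net point, [x]. *)
Lemma totally_bounded_meq_refl : totally_bounded X -> forall x : X, meq x x.
Proof.
  intros X_tb x; apply dist_zero; split; [apply dist_nonneg|].
  intros pos; destruct (CRpositive_half _ pos) as [h [h_pos h_half]].
  destruct (X_tb h h_pos) as [n [net net_dense]]; destruct (net_dense x) as [i xi].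
  assert (lt : dist x x < dist x x)
    by exact (dist_triangle_lt x (net i) x h h _ xi (dist_sym_lt _ _ _ xi) h_half).
  exact (CRlt_asym _ _ lt lt).
Qed.

Variable a : X.

Definition adjoin_point_eq (u v : option X) : Prop :=
  match u, v with
  | Some x, Some y => meq x y
  | None, None => True
  | _, _ => False
  end.

(** As if a segment of length 1 were glued to [X] at [a], with [None] at its far end: the new point
    stays at least 1 away from [X] without any bound on the diameter. *)
Definition adjoin_point_dist (u v : option X) : CRcarrier R :=
  match u, v with
  | Some x, Some y => dist x y
  | None, None => 0
  | Some x, None | None, Some x => 1 + dist a x
  end.

Lemma one_plus_dist_ge_one (x : X) : 1 <= 1 + dist a x.
Proof.
  rewrite <- (CRplus_0_r 1) at 1.
  apply CRplus_le_compat_l, dist_nonneg.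
Qed.

Lemma one_plus_dist_nonneg (x : X) : 0 <= 1 + dist a x.
Proof.
  apply (CRle_trans _ 1); [apply CRlt_asym, CRzero_lt_one |].
  apply one_plus_dist_ge_one.
Qed.

Lemma one_plus_dist_nonzero (x : X) : ~ 1 + dist a x == 0.
Proof.
  intros [_ le0]; apply le0, (CRlt_le_trans _ 1 _ (CRzero_lt_one R)).
  apply one_plus_dist_ge_one.
Qed.

Lemma one_plus_dist_triangle (x y : X) :
  1 + dist a y <= (1 + dist a x) + dist x y.
Proof.
  rewrite CRplus_assoc; apply CRplus_le_compat_l, dist_triangle.
Qed.

Lemma le_one_plus_dist (x : X) : dist a x <= 1 + dist a x.
Proof.
  rewrite <- (CRplus_0_l (dist a x)) at 1.
  apply CRplus_le_compat_r, CRlt_asym, CRzero_lt_one.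
Qed.

(** Transparent, so that [meq] and [dist] compute on [Some] and [None]. *)
Definition adjoin_point : MetricSpace R.
Proof.
  refine (Build_MetricSpace R (option X) adjoin_point_eq adjoin_point_dist
            _ _ _ _).
  - intros [x|] [y|]; simpl;
      auto using dist_nonneg, one_plus_dist_nonneg, CRle_refl.
  - intros [x|] [y|]; simpl; [apply dist_zero | | |].
    1-2: split; [apply one_plus_dist_nonzero | easy].
    split; [easy | reflexivity].
  - intros [x|] [y|]; simpl; [apply dist_sym | reflexivity..].
  - intros [x|] [y|] [z|]; simpl.
    + apply dist_triangle.
    + rewrite (dist_sym _ _ x y), (CRplus_comm (dist y x)); apply one_plus_dist_triangle.
    + eapply CRle_trans; [apply (dist_triangle _ _ x a z)|].
      rewrite (dist_sym _ _ x a).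
      apply CRplus_le_compat; apply le_one_plus_dist.
    + rewrite CRplus_0_r; apply CRle_refl.
    + apply one_plus_dist_triangle.
    + rewrite <- (CRplus_0_l 0).
      apply CRplus_le_compat; apply one_plus_dist_nonneg.
    + rewrite CRplus_0_l; apply CRle_refl.
    + rewrite CRplus_0_l; apply CRle_refl.
Defined.

Lemma adjoin_point_extension :
  one_point_extension (E := adjoin_point) Some None.
Proof.
  split; [intros x y; reflexivity|].
  exists 1; split; [apply CRzero_lt_one|].
  intros [y|] [x e]; [apply one_plus_dist_ge_one | destruct e].
Qed.

(** Each [inr] is sent to the adjoined point, so an index where the sequence meets that point
    carries a proof of [Q n]. Only the [inl] terms have to be kept away from [x]. *)
Lemma limited_anti_Specker_escape (Q : nat -> Type) (s : forall n, X + Q n) :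
  (forall x : X, meq x x) -> limited_anti_Specker X ->
  (forall x : X, { N : nat & { delta : CRcarrier R &
     ((0 < delta) *
      (forall n y, (N <= n)%nat -> s n = inl y -> delta <= dist x y))%type }}) ->
  { n : nat & Q n }.
Proof.
  intros meq_refl AS away.
  set (t := fun n => match s n with inl y => Some y | inr _ => None end).
  destruct (AS adjoin_point Some None adjoin_point_extension t) as [n tn].
  - intros n; unfold t; destruct (s n) as [y|_].
    + left; exists y; apply meq_refl.
    + right; exact I.
  - intros x; destruct (away x) as [N [delta [delta_pos sep]]].
    (* [delta] serves the terms in [X], and 1 the adjoined point. *)
    exists N, (CRmin delta 1); split.
    + apply CRmin_lt; [exact delta_pos | apply CRzero_lt_one].
    + intros n n_ge; unfold t; destruct (s n) as [y|] eqn:sn; simpl.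
      * apply (CRle_trans _ delta); [apply CRmin_l | now apply (sep n)].
      * apply (CRle_trans _ 1); [apply CRmin_r | apply one_plus_dist_ge_one].
  - exists n; unfold t in tn; destruct (s n) as [y|Qn]; [destruct tn | exact Qn].
Qed.

End Metric.

(** * Norm control and bad points *)

Lemma norm_le_sub {R : ConstructiveReals} {Y : NormedSpace R} (u v : Y) :
  norm u <= norm (vadd u (vopp v)) + norm v.
Proof.
  destruct (veq_equiv _ Y) as [veq_refl veq_sym veq_trans].
  rewrite (norm_ext _ _ u (vadd (vadd u (vopp v)) v)).
  - apply norm_triangle.
  - apply veq_sym.
    eapply veq_trans; [apply veq_sym, vadd_assoc|].
    eapply veq_trans; [|apply vadd_zero].
    apply vadd_ext; [apply veq_refl|].
    eapply veq_trans; [apply vadd_comm | apply vadd_opp].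
Qed.

Section ZStability.

Context {R : ConstructiveReals} {X : MetricSpace R} {Y : NormedSpace R}.
Variables (f : X -> Y) (z : nat -> X).

Lemma norm_control (f_uc : uniformly_continuous f) (eps : CRcarrier R) :
  0 < eps ->
  { mu : CRcarrier R & { eta : CRcarrier R &
    ((0 < mu) * (0 < eta) *
     (forall x y, dist x y < eta -> norm (f y) < mu -> norm (f x) < eps))%type
  }}.
Proof.
  intros eps_pos; destruct (CRpositive_half eps eps_pos) as [mu [mu_pos mu_half]].
  destruct (f_uc mu mu_pos) as [eta [eta_pos f_eta]].
  exists mu, eta; repeat split; [exact mu_pos | exact eta_pos |].
  intros x y xy fy; apply (CRlt_le_trans _ (mu + mu)); [|exact mu_half].
  eapply CRle_lt_trans; [apply (norm_le_sub _ (f y))|].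
  apply CRplus_lt_compat; [now apply f_eta | exact fy].
Qed.

Definition bad_point (q nu : CRcarrier R) (n : nat) (x : X) : Type :=
  ((norm (f x) < nu) * (forall k, (k <= n)%nat -> q < dist x (z k)))%type.

(** The gaps [nu' < nu] and [q < h] let every net point be classified as bad, of norm above [nu'],
    or within [h] of some [z k]. If none is bad, a point of small norm has a net neighbour of the
    third kind. *)
Lemma bad_point_or_uniform (X_tb : totally_bounded X)
    (f_uc : uniformly_continuous f) (z_zero : forall n, zero_set f (z n))
    (eps h q nu : CRcarrier R) (n : nat) :
  0 < h -> h + h <= eps -> q < h -> 0 < nu ->
  { x : X & bad_point q nu n x } +
  { delta : CRcarrier R & ((0 < delta) *
      (forall x, norm (f x) < delta -> dist_to_lt x (zero_set f) eps))%type }.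
Proof.
  intros h_pos h_half q_lt nu_pos.
  destruct (CRpositive_half nu nu_pos) as [nu' [nu'_pos nu'_half]].
  assert (nu'_lt : nu' < nu).
  { apply (CRlt_le_trans _ (nu' + nu')); [|exact nu'_half].
    apply (CRle_lt_trans _ (nu' + 0)); [apply CRplus_0_r|].
    now apply CRplus_lt_compat_l. }
  destruct (norm_control f_uc nu' nu'_pos) as [mu [eta [[mu_pos eta_pos] ctl]]].
  (* Mesh [eta] transfers small norms to the net; mesh [h] leaves [h] for the distance from the net
     to the zero set. *)
  destruct (X_tb (CRmin eta h)) as [m [net net_dense]];
    [now apply CRmin_lt|].
  destruct (Fin_search m (fun i => bad_point q nu n (net i))
    (fun i => (nu' < norm (f (net i))) + { k : nat & dist (net i) (z k) < h })%type)
    as [[i bad]|good].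
  - intros i; destruct (CRlt_cotrans nu' (norm (f (net i))) nu nu'_lt) as [big|small];
      [right; now left|].
    destruct (bounded_search (fun k => dist (net i) (z k) < h)
                (fun k => q < dist (net i) (z k)) n) as [near|far].
    + intros k; destruct (CRlt_cotrans q (dist (net i) (z k)) h q_lt); auto.
    + right; now right.
    + left; now split.
  - left; now exists (net i).
  - right; exists mu; split; [exact mu_pos|].
    intros x fx; destruct (net_dense x) as [i xi].
    destruct (good i) as [big|[k near]].
    + exfalso; apply (CRlt_asym _ _ big), (ctl _ x); [|exact fx].
      apply dist_sym_lt, (CRlt_le_trans _ _ _ xi), CRmin_l.
    + exists (z k); split; [apply z_zero|].
      apply (dist_triangle_lt _ (net i) _ h h); [|exact near | exact h_half].
      apply (CRlt_le_trans _ _ _ xi), CRmin_r.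
Qed.

Lemma bad_points_bounded_away (f_uc : uniformly_continuous f)
    (z_dense : forall x, zero_set f x -> forall eps, 0 < eps ->
       { n : nat & dist x (z n) < eps })
    (q : CRcarrier R) (q_pos : 0 < q) (x : X) (f_stable : Z_stable_at f x) :
  { N : nat & { delta : CRcarrier R &
    ((0 < delta) *
     (forall n y, (N <= n)%nat -> bad_point q (CRinv_succ R n) n y ->
        delta <= dist x y))%type }}.
Proof.
  (* If [x] is within [d + d <= c] of some [z N], a point within [c] of [x] is within [c + c <= q]
     of [z N]. *)
  destruct (CRpositive_half q q_pos) as [c [c_pos c_half]].
  destruct (CRpositive_half c c_pos) as [d [d_pos d_half]].
  destruct (f_stable d d_pos) as [delta [delta_pos stable]].
  destruct (CRpositive_half delta delta_pos) as [delta' [delta'_pos delta'_half]].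
  assert (delta'_lt : delta' < delta).
  { apply (CRlt_le_trans _ (delta' + delta')); [|exact delta'_half].
    apply (CRle_lt_trans _ (delta' + 0)); [apply CRplus_0_r|].
    now apply CRplus_lt_compat_l. }
  destruct (CRlt_cotrans delta' (norm (f x)) delta delta'_lt) as [big|small].
  - destruct (norm_control f_uc delta' delta'_pos)
      as [mu [eta [[mu_pos eta_pos] ctl]]].
    destruct (CRinv_succ_small mu mu_pos) as [N N_small].
    exists N, eta; split; [exact eta_pos|].
    intros n y n_ge [fy _] xy; apply (CRlt_asym _ _ big), (ctl x y xy).
    apply (CRlt_le_trans _ _ _ fy), N_small, n_ge.
  - destruct (stable small) as [w [fw xw]].
    (* The index of the zero near [w] is also the stage bound: from stage [N] on, bad points avoid
       [z N]. *)
    destruct (z_dense w fw d d_pos) as [N wz].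
    exists N, c; split; [exact c_pos|].
    intros n y n_ge [_ far] xy; apply (CRlt_asym _ _ (far N n_ge)).
    apply (dist_triangle_lt y x _ c c); [now apply dist_sym_lt | | exact c_half].
    now apply (dist_triangle_lt _ w _ d d).
Qed.

End ZStability.

Theorem proposition4p1 (R : ConstructiveReals) (X : MetricSpace R)
    (Y : NormedSpace R) (f : X -> Y)
    (X_compact : compact X)
    (X_antiSpecker : limited_anti_Specker X)
    (f_Z_stable : Z_stable f)
    (f_uniformly_continuous : uniformly_continuous f)
    (Zf_separable : separable (zero_set f)) :
  uniformly_Z_stable f.
Proof.
  intros eps eps_pos.
  destruct X_compact as [_ X_tb], Zf_separable as [z [z_zero z_dense]].
  destruct (CRpositive_half eps eps_pos) as [h [h_pos h_half]].
  destruct (CR_Q_dense R _ _ h_pos) as [q [q_pos q_lt]].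
  set (stage := fun n => bad_point_or_uniform f z X_tb f_uniformly_continuous
    z_zero eps h (CR_of_Q R q) (CRinv_succ R n) n h_pos h_half q_lt
    (CRinv_succ_pos R n)).
  (* The dense sequence provides a base point for the extension. The escape family is constant,
     equal to the goal for this [eps]. *)
  destruct (limited_anti_Specker_escape (z 0%nat) _
    (fun n => match stage n with
              | inl bad => inl (projT1 bad)
              | inr uniform => inr uniform
              end) (totally_bounded_meq_refl X_tb) X_antiSpecker)
    as [_ uniform]; [|exact uniform].
  intros x.
  destruct (bad_points_bounded_away f z f_uniformly_continuous z_dense
    (CR_of_Q R q) q_pos x (f_Z_stable x)) as [N [delta [delta_pos away]]].
  exists N, delta; split; [exact delta_pos|].
  intros n y n_ge; destruct (stage n) as [[y' bad]|uniform]; simpl;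
    intros e; inversion e; subst y.
  now apply (away n).
Qed.
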